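(* The family $\mathcal{T}_{\mathcal{M}3}$ of all finite trees having at least two vertices and all of whose vertices have order at most $3$, together with all monotone epimorphisms between them, has the joint projection property and the projective amalgamation property. That is: (JPP) for any $B,C\in\mathcal{T}_{\mathcal{M}3}$ there are $D\in\mathcal{T}_{\mathcal{M}3}$ and monotone epimorphisms $D\to B$, $D\to C$; (AP) for any $A,B,C\in\mathcal{T}_{\mathcal{M}3}$ and monotone epimorphisms $f\colon B\to A$, $g\colon C\to A$ there are $D\in\mathcal{T}_{\mathcal{M}3}$ and monotone epimorphisms $f_0\colon D\to B$, $g_0\colon D\to C$ with $f\circ f_0=g\circ g_0$.
   Context: A graph is a pair $A=(V(A),E(A))$ with $E(A)\subseteq V(A)^2$ reflexive and symmetric; edges $\langle a,a\rangle$ are called degenerate. A homomorphism $f\colon A\to B$ is a map $V(A)\to V(B)$ sending edges to edges; an epimorphism is a homomorphism that is surjective on vertices and on edges (every edge of $B$ is the image of an edge of $A$). A tree is a finite graph $T$ such that any two distinct vertices $a,b$ are joined by a unique sequence $a=v_0,\dots,v_n=b$ of pairwise distinct vertices with $\langle v_i,v_{i+1}\rangle\in E(T)$. The order of a vertex is the number of non-degenerate edges containing it. A set $S\subseteq V(G)$ is disconnected if $S=P\cup Q$ with $P,Q$ nonempty, disjoint, closed, and no edge $\langle a,b\rangle\in E(G)$ with $a\in P$, $b\in Q$; otherwise $S$ is connected. An epimorphism $f\colon G\to H$ is monotone if the preimage of every (closed) connected subset of $V(H)$ is connected. *)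

(* Defs.v *)
From mathcomp Require Import all_boot.
Set Implicit Arguments. Unset Strict Implicit. Unset Printing Implicit Defensive.

Definition is_graph (T : finType) (e : rel T) : Prop := reflexive e /\ symmetric e.

Definition homomorphism (A B : finType) (eA : rel A) (eB : rel B) (f : A -> B) : Prop :=
  forall a a', eA a a' -> eB (f a) (f a').

Definition epimorphism (A B : finType) (eA : rel A) (eB : rel B) (f : A -> B) : Prop :=
  [/\ homomorphism eA eB f,
      (forall b, exists a, f a = b) &
      (forall b b', eB b b' -> exists a a', [/\ eA a a', f a = b & f a' = b'])].

Definition simple_path (T : finType) (e : rel T) (a b : T) (p : seq T) : bool :=
  [&& path e a p, last a p == b & uniq (a :: p)].

Definition is_tree (T : finType) (e : rel T) : Prop :=
  is_graph e /\
  forall a b : T, a != b ->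
    exists p, simple_path e a b p /\ forall q, simple_path e a b q -> q = p.

Definition vorder (T : finType) (e : rel T) (a : T) : nat :=
  #|[set b | e a b & b != a]|.

(* S is disconnected if it splits into two nonempty disjoint parts with no edge
   between them (in a finite graph every vertex set is closed). *)
Definition disconnected (T : finType) (e : rel T) (S : {set T}) : Prop :=
  exists P Q : {set T},
    [/\ S = P :|: Q, P != set0, Q != set0, [disjoint P & Q] &
        forall a b, a \in P -> b \in Q -> ~~ e a b].

Definition connected (T : finType) (e : rel T) (S : {set T}) : Prop :=
  ~ disconnected e S.

Definition monotone (A B : finType) (eA : rel A) (eB : rel B) (f : A -> B) : Prop :=
  epimorphism eA eB f /\
  forall S : {set B}, connected eB S -> connected eA (f @^-1: S).

Definition TM3 (T : finType) (e : rel T) : Prop :=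
  [/\ is_tree e, 2 <= #|T| & forall v : T, vorder e v <= 3].

(* Main.v *)
(* Induct on |B|, for arbitrary C.  If f is injective, take D = C.  Otherwise some
   fibre of f has at least two vertices; being a subtree it has two leaves, and
   since the edges leaving it map injectively to the at most three edges at the
   image vertex, one of these leaves, b, has order at most 2 in B.  Contract b
   into a neighbour b' in its fibre: B is recovered from the quotient B' either by
   attaching b as a leaf at b' (whose order in B' is then at most 2), or by
   subdividing the edge b'c' by b.  Amalgamate B' with C by induction and lift the
   operation along D' -> B': attach a leaf at a vertex of order at most 2 in the
   fibre of b', or subdivide the unique edge of D' above b'c'.  The joint
   projection property is the same statement over a one-vertex tree. *)
Require Import Defs.
From mathcomp Require Import all_boot.

Set Implicit Arguments. Unset Strict Implicit. Unset Printing Implicit Defensive.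

(** * Transport of connectivity along maps *)

Lemma connect_hom (S T : finType) (r : rel S) (s : rel T) (h : S -> T) x y :
  (forall x y, r x y -> connect s (h x) (h y)) ->
  connect r x y -> connect s (h x) (h y).
Proof.
move=> hom /connectP[p]; elim: p x => [|z p IHp] x /=; first by move=> _ ->.
by case/andP=> rxz zp lastp; apply: connect_trans (hom _ _ rxz) (IHp _ zp lastp).
Qed.

(** Each edge of the path below lifts, and the lifts of consecutive edges are joined inside a
    fibre. *)
Lemma connect_lift (S T : finType) (r : rel S) (s : rel T) (h : S -> T) x y :
  (forall x' y', s x' y' -> exists x y, [/\ r x y, h x = x' & h y = y']) ->
  (forall x y, h x = h y -> connect r x y) ->
  connect s (h x) (h y) -> connect r x y.
Proof.
move=> lift fibres /connectP[p]; elim: p x => [|z p IHp] x /=.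
  by move=> _ /esym /fibres.
case/andP=> /lift[x1 [y1 [rxy hx hy]]] zp lastp.
apply: connect_trans (fibres _ _ (esym hx)) _.
apply: connect_trans (connect1 rxy) _.
by apply: IHp; rewrite hy.
Qed.

Lemma connect_closed (T : finType) (r : rel T) (P : {pred T}) x y :
  (forall x y, x \in P -> r x y -> y \in P) ->
  connect r x y -> x \in P -> y \in P.
Proof.
move=> clos /connectP[p]; elim: p x => [|z p IHp] x /=; first by move=> _ ->.
by case/andP=> rxz zp lastp Px; apply: IHp zp lastp (clos _ _ Px rxz).
Qed.

(** * Trees as connected graphs in which every edge is a bridge *)

Definition del_edge (T : finType) (e : rel T) (x y : T) : rel T :=
  fun z w => e z w && ~~ (((z, w) == (x, y)) || ((z, w) == (y, x))).

Lemma del_edge_sym (T : finType) (e : rel T) x y :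
  symmetric e -> symmetric (del_edge e x y).
Proof.
move=> sym z w; rewrite /del_edge sym !xpair_eqE; congr (_ && ~~ _).
by rewrite orbC andbC [X in _ || X]andbC.
Qed.

(** Acyclicity phrased through connectivity, so that it moves along maps by [connect_hom] and
    [connect_lift] without handling path sequences. *)
Definition bridged (T : finType) (e : rel T) :=
  forall x y, x != y -> e x y -> ~~ connect (del_edge e x y) x y.

Lemma path_avoid (T : finType) (e : rel T) x y z p :
  path e z p -> x \notin z :: p -> path (del_edge e x y) z p.
Proof.
elim: p z => //= w p IHp z /andP[zw wp]; rewrite !inE !negb_or => /and3P[xz xw xp].
rewrite IHp ?inE ?negb_or ?xw // andbT /del_edge zw !xpair_eqE.
by rewrite negb_or !negb_and ![_ == x]eq_sym xz xw orbT.
Qed.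

Lemma tree_connect (T : finType) (e : rel T) x y : is_tree e -> connect e x y.
Proof.
case=> _ uniqp; have [-> //|/uniqp[p [/and3P[ep /eqP lp _] _]]] := eqVneq x y.
by apply/connectP; exists p.
Qed.

Lemma tree_bridged (T : finType) (e : rel T) : is_tree e -> bridged e.
Proof.
case=> _ uniqp x y nxy exy; apply/negP=> /connectP[p0 /shortenP[p pth up _] lastp].
have [q [_ uq]] := uniqp _ _ nxy.
have Dp : p = q.
  apply: uq; rewrite /simple_path up -lastp eqxx !andbT.
  by apply: sub_path pth => z w /andP[].
have Dy : [:: y] = q by apply: uq; rewrite /simple_path /= exy eqxx inE nxy.
by move: pth; rewrite Dp -Dy /= /del_edge eqxx andbF.
Qed.

Lemma bridged_tree (T : finType) (e : rel T) :
  is_graph e -> (forall x y, connect e x y) -> bridged e -> is_tree e.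
Proof.
move=> grph conn brd; have [refle syme] := grph; split=> // a b nab.
have /connectP[p0 /shortenP[p pth up _] lastp] := conn a b.
exists p; split; first by rewrite /simple_path pth up lastp eqxx.
move=> q /and3P[qth /eqP lastq uq].
rewrite -lastq in lastp.
elim: p a q pth up qth uq lastp {lastq conn p0 nab} => [|x p IHp] a [|y q] //=.
- by move=> _ _ _ /andP[aq _] aE; move: aq; rewrite -{1}aE mem_last.
- by move=> _ /andP[ap _] _ _ aE; move: ap; rewrite {1}aE mem_last.
case/andP=> ax xp /andP[ap up] /andP[ay yq] /andP[aq uq] lastE.
have [Dy | nxy] := eqVneq x y.
  by rewrite -Dy in yq aq uq lastE *; rewrite (IHp _ _ xp up yq uq lastE).
have nax : a != x by move: ap; rewrite inE negb_or => /andP[].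
(* Where the two simple paths part, [x] is joined to [a] around the edge [ax]: along [p] to the
   common end, back along [q] to [y], then to [a]. *)
case/negP: (brd _ _ nax ax).
have sc := sym_connect_sym (del_edge_sym a x syme).
rewrite sc; apply: connect_trans (_ : connect _ (last x p) _).
  by apply/connectP; exists p => //; apply: path_avoid.
rewrite sc -lastE; apply: connect_trans (_ : connect _ y _).
  apply: connect1; rewrite /del_edge ay !xpair_eqE eqxx /= eq_sym (negPf nxy) /=.
  by rewrite (negPf nax).
by apply/connectP; exists q => //; apply: path_avoid.
Qed.

(** * Monotone epimorphisms as epimorphisms with connected fibres *)

Definition fibre_rel (S T : finType) (e : rel S) (f : S -> T) : rel S :=
  fun x y => e x y && (f x == f y).

Lemma connect_fibre (S T : finType) (e : rel S) (f : S -> T) x y :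
  connect (fibre_rel e f) x y -> f y = f x.
Proof.
move=> xy; apply/eqP; have : y \in [pred z | f z == f x]; last by rewrite inE.
apply: (connect_closed _ xy); rewrite ?inE // => u v.
by rewrite !inE => /eqP <- /andP[_ /eqP->].
Qed.

(** A singleton is connected, hence so is its preimage; otherwise the component of [x] and the rest
    of the fibre would separate it. *)
Lemma monotone_fibre (S T : finType) (eS : rel S) (eT : rel T) (f : S -> T) x y :
  monotone eS eT f -> f x = f y -> connect (fibre_rel eS f) x y.
Proof.
case=> _ mono fxy; apply/idP; apply: contraT => nconn.
have /mono[] : connected eT [set f x].
  case=> P [Q [PQ /set0Pn[p Pp] /set0Pn[q Qq] dPQ _]].
  have /set1P Dp : p \in [set f x] by rewrite PQ inE Pp.
  have /set1P Dq : q \in [set f x] by rewrite PQ inE Qq orbT.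
  by move/pred0P/(_ p): dPQ; rewrite /= Pp Dp -Dq Qq.
exists [set z | connect (fibre_rel eS f) x z].
exists [set z | (f z == f x) && ~~ connect (fibre_rel eS f) x z]; split.
- apply/setP=> z; rewrite !inE; case: (boolP (connect _ x z)) => [xz|]; rewrite ?andbT //=.
  by rewrite (connect_fibre xz) eqxx.
- by apply/set0Pn; exists x; rewrite inE.
- by apply/set0Pn; exists y; rewrite inE fxy eqxx.
- by apply/pred0P=> z; rewrite /= !inE; case: connect; rewrite ?andbF.
move=> a b; rewrite !inE => xa /andP[/eqP fb]; apply: contra => ab.
have fa := connect_fibre xa.
by apply: connect_trans xa (connect1 _); rewrite /fibre_rel ab fa fb /=.
Qed.

(** If [P] and [Q] separate the preimage of [U], no connected fibre meets both. Their images are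
    therefore disjoint, and since edges lift, they separate [U]. *)
Lemma monotoneI (S T : finType) (eS : rel S) (eT : rel T) (f : S -> T) :
  epimorphism eS eT f -> (forall x y, f x = f y -> connect (fibre_rel eS f) x y) ->
  monotone eS eT f.
Proof.
move=> epi fibres; split=> // U conU [P [Q [PQ /set0Pn[p Pp] /set0Pn[q Qq] dPQ noPQ]]].
have [_ surj lift] := epi.
have memPQ z : (f z \in U) = (z \in P) || (z \in Q) by rewrite -in_setU -PQ inE.
have fPQ x y : x \in P -> y \in Q -> f x != f y.
  move=> Px Qy; apply/eqP=> /fibres xy.
  have Py : y \in P.
    apply: (connect_closed _ xy) Px => u v Pu /andP[uv /eqP fuv].
    have := memPQ v; rewrite -fuv memPQ Pu /= => /esym/orP[//|Qv].
    by case/negP: (noPQ _ _ Pu Qv).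
  by move/pred0P/(_ y): dPQ; rewrite /= Py Qy.
apply: conU; exists (f @: P), (f @: Q); split.
- apply/setP=> u; have [z <-] := surj u; rewrite memPQ inE; apply/idP/idP.
    by case/orP=> Hz; rewrite (imset_f f Hz) ?orbT.
  case/orP=> /imsetP[w Hw Dw]; have := memPQ w; rewrite Hw ?orbT -Dw memPQ //.
- by apply/set0Pn; exists (f p); rewrite imset_f.
- by apply/set0Pn; exists (f q); rewrite imset_f.
- apply/pred0P=> u /=; apply/negP=> /andP[/imsetP[x Px ->] /imsetP[y Qy /eqP]].
  by rewrite (negPf (fPQ _ _ Px Qy)).
move=> _ _ /imsetP[x Px ->] /imsetP[y Qy ->]; apply/negP=> /lift[x' [y' [xy fx fy]]].
have Px' : x' \in P.
  have := memPQ x'; rewrite fx memPQ Px /= => /esym/orP[//|Qx'].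
  by have := fPQ _ _ Px Qx'; rewrite fx eqxx.
have Qy' : y' \in Q.
  have := memPQ y'; rewrite fy memPQ Qy orbT /= => /esym/orP[Py'|//].
  by have := fPQ _ _ Py' Qy; rewrite fy eqxx.
by case/negP: (noPQ _ _ Px' Qy').
Qed.

Lemma monotone_comp (R S T : finType) (eR : rel R) (eS : rel S) (eT : rel T)
    (f : R -> S) (g : S -> T) :
  monotone eR eS f -> monotone eS eT g -> monotone eR eT (g \o f).
Proof.
case=> [[homf surjf liftf] monof] [[homg surjg liftg] monog]; split=> [|U /monog/monof]; last first.
  by congr (connected _ _); apply/setP=> x; rewrite !inE.
split=> [x y /homf/homg //|z|z z' /liftg[y [y' [eyy <- <-]]]].
  by have [y <-] := surjg z; have [x <-] := surjf y; exists x.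
by have [x [x' [exx <- <-]]] := liftf _ _ eyy; exists x, x'.
Qed.

(** Vertices and edges of [S] lift along [f], which carries paths inside a fibre of [g \o f] to
    paths inside a fibre of [g]. This makes the map induced on a quotient monotone. *)
Lemma monotone_factor (R S T : finType) (eR : rel R) (eS : rel S) (eT : rel T)
    (f : R -> S) (g : S -> T) :
  epimorphism eR eS f -> monotone eR eT (g \o f) -> monotone eS eT g.
Proof.
move=> [homf surjf liftf] monogf; have [[homgf surjgf liftgf] _] := monogf.
apply: monotoneI; first split.
- by move=> y y' /liftf[x [x' [/homgf exx <- <-]]].
- by move=> z; have [x <-] := surjgf z; exists (f x).
- by move=> z z' /liftgf[x [x' [/homf exx <- <-]]]; exists (f x), (f x').
move=> y y'; have [x <-] := surjf y; have [x' <-] := surjf y'.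
move/(@monotone_fibre _ _ _ _ (g \o f) _ _ monogf); apply: connect_hom => u v.
by case/andP=> /homf uv guv; apply: connect1; rewrite /fibre_rel uv.
Qed.

(** * Monotone images of trees and unique lifting of edges *)

Lemma fibre_avoid (S T : finType) (e : rel S) (f : S -> T) x y u v :
  f u != f v -> connect (fibre_rel e f) x y -> connect (del_edge e u v) x y.
Proof.
move=> nuv; apply: connect_sub => z w /andP[zw /eqP fzw]; apply: connect1.
rewrite /del_edge zw; apply/negP; rewrite !xpair_eqE => /orP[]/andP[/eqP Dz /eqP Dw];
by move: nuv; rewrite -Dz -Dw fzw eqxx.
Qed.

(** A path around the edge [uv] would lift, through the connected fibres, to a path around an edge
    of [S] above [uv]. *)
Lemma monotone_tree (S T : finType) (eS : rel S) (eT : rel T) (f : S -> T) :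
  is_tree eS -> is_graph eT -> monotone eS eT f -> is_tree eT.
Proof.
move=> treeS graphT mono; have [[hom surj lift] _] := mono.
apply: bridged_tree => // [u v|u v nuv euv].
  have [x <-] := surj u; have [y <-] := surj v.
  apply: (connect_hom _ (tree_connect x y treeS)) => z w ezw.
  exact/connect1/hom.
have [x [y [exy Du Dv]]] := lift _ _ euv; rewrite -Du -Dv in nuv *.
have nxy : x != y by apply: contraNneq nuv => ->.
apply: contra (tree_bridged treeS nxy exy); apply: connect_lift => [z w|z w fzw].
  case/andP=> /lift[z' [w' [ezw <- <-]]]; rewrite !xpair_eqE => nd.
  exists z', w'; split=> //; rewrite /del_edge ezw; apply: contra nd.
  by rewrite !xpair_eqE => /orP[]/andP[/eqP-> /eqP->]; rewrite !eqxx ?orbT.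
by apply: fibre_avoid nuv _; apply: monotone_fibre mono fzw.
Qed.

(** Two distinct edges over the same non-degenerate edge would form a cycle with paths inside the
    two end fibres. *)
Lemma lift_edge_uniq (S T : finType) (eS : rel S) (eT : rel T) (f : S -> T) x y x' y' :
  is_tree eS -> monotone eS eT f -> eS x y -> eS x' y' ->
  f x = f x' -> f y = f y' -> f x != f y -> x = x' /\ y = y'.
Proof.
move=> treeS mono exy exy' fx fy nf.
have nxy : x != y by apply: contraNneq nf => ->.
have := tree_bridged treeS nxy exy.
have [[-> ->] //| nd /negP[]] := eqVneq (x', y') (x, y).
apply: connect_trans (_ : connect _ x' _).
  exact: fibre_avoid nf (monotone_fibre mono fx).
apply: connect_trans (_ : connect _ y' _); last first.
  exact: fibre_avoid nf (monotone_fibre mono (esym fy)).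
apply: connect1; rewrite /del_edge exy' negb_or nd /= xpair_eqE.
by apply: contra nf => /andP[/eqP Dx _]; rewrite fx Dx.
Qed.

(** * Vertices of low order in the fibres *)

(* The endpoint of a longest simple path starting at [r]. *)
Lemma leaf_neq (T : finType) (e : rel T) (r s : T) :
  symmetric e -> bridged e -> r != s -> connect e r s ->
  exists l, [/\ l != r, connect e r l & vorder e l <= 1].
Proof.
move=> syme brd nrs /connectP[p0 /shortenP[p pth up _] lastp].
pose P n := [exists t : n.-tuple T, path e r t && uniq (r :: t)].
have PI t : path e r t -> uniq (r :: t) -> P (size t).
  by move=> et ut; apply/existsP; exists (in_tuple t); rewrite et ut.
have exP : exists n, P n by exists (size p); apply: PI.
have leP n : P n -> n <= #|T|.
  case/existsP=> t /andP[_ /= /andP[_ /card_uniqP]]; rewrite size_tuple => <-.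
  exact: max_card.
case: (ex_maxnP exP leP) => n /existsP[t0 /andP[et /= /andP[rt ut]]].
rewrite -(size_tuple t0) => maxt.
case/lastP: {n t0}(tval t0) et rt ut maxt => [|t l] et rt ut maxt.
  have := maxt _ (PI _ pth up); rewrite leqn0 => /nilP p0E.
  by move: nrs; rewrite lastp p0E eqxx.
have elt : connect e r l by apply/connectP; exists (rcons t l); rewrite ?last_rcons.
move: rt; rewrite mem_rcons inE negb_or eq_sym => /andP[nlr rt].
exists l; split=> //; rewrite leqNgt; apply/negP=> /card_gt1P[y1 [y2 []]].
rewrite !inE => ey1 ey2 ny12.
(* Of two neighbours of [l], at least one is not its predecessor on the path. *)
have [y [/andP[ely nyl] nyz]] : exists y, (e l y && (y != l)) /\ y != last r t.
  have [Dy1|] := eqVneq y1 (last r t); last by exists y1.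
  by exists y2; rewrite -Dy1 [y2 == y1]eq_sym.
move: (et); rewrite rcons_path => /andP[et' etl].
have ntl : l \notin r :: t.
  by move: ut; rewrite rcons_uniq inE negb_or nlr => /andP[].
(* Off the path, [y] would prolong a longest path; on it, the segment from [y] to [l] goes around
   the edge [yl]. *)
have [yt|nyt] := boolP (y \in r :: t); last first.
  have : size (rcons (rcons t l) y) <= size (rcons t l); last by rewrite size_rcons ltnn.
  apply/maxt/PI; first by rewrite rcons_path et last_rcons.
  rewrite -rcons_cons rcons_uniq /= ut !(inE, mem_rcons) !negb_or nyl.
  move: nyt; rewrite inE negb_or => /andP[-> ->] /=.
  by rewrite eq_sym nlr rt.
rewrite eq_sym in nyl; case/negP: (brd _ _ nyl ely).
rewrite (sym_connect_sym (del_edge_sym _ _ syme)).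
apply: connect_trans (_ : connect _ (last r t) _); last first.
  apply: connect1; rewrite /del_edge etl !xpair_eqE eqxx andbT (negPf nyl).
  by rewrite andbF eq_sym (negPf nyz).
case/splitPl: yt et' ntl => t1 t2 lastt1; rewrite cat_path lastt1 => /andP[_ yt2].
rewrite -cat_cons mem_cat negb_or last_cat lastt1 => /andP[_ nlt2].
apply/connectP; exists t2 => //; apply: path_avoid => //.
by rewrite inE negb_or nyl.
Qed.

Lemma fibre_rel_bridged (S T : finType) (e : rel S) (f : S -> T) :
  bridged e -> bridged (fibre_rel e f).
Proof.
move=> brd x y nxy /andP[exy _]; apply: contra (brd _ _ nxy exy).
apply: connect_sub => z w /andP[/andP[ezw _] nd]; apply: connect1.
by rewrite /del_edge ezw.
Qed.

Lemma fibre_rel_sym (S T : finType) (e : rel S) (f : S -> T) :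
  symmetric e -> symmetric (fibre_rel e f).
Proof. by move=> syme x y; rewrite /fibre_rel syme eq_sym. Qed.

Definition exits (S T : finType) (e : rel S) (f : S -> T) (x : S) : {set S} :=
  [set y | e x y & f y != f x].

Lemma vorder_exits (S T : finType) (e : rel S) (f : S -> T) (x : S) :
  vorder e x = vorder (fibre_rel e f) x + #|exits e f x|.
Proof.
rewrite /vorder -(cardsID [set y | f x == f y]); congr (_ + _); apply: eq_card => y.
  by rewrite !inE /fibre_rel -andbA [(y != x) && _]andbC andbA.
rewrite !inE eq_sym; have [->|] := eqVneq y x; first by rewrite eqxx !andbF.
by rewrite andbT andbC.
Qed.

Lemma exits_image (S T : finType) (eS : rel S) (eT : rel T) (f : S -> T) x :
  is_tree eS -> monotone eS eT f ->
  #|f @: exits eS f x| = #|exits eS f x| /\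
  f @: exits eS f x \subset [set b | eT (f x) b & b != f x].
Proof.
move=> treeS mono; have [[hom _ _] _] := mono; split.
  apply: card_in_imset => y y'; rewrite !inE => /andP[xy ny] /andP[xy' _] fyy.
  by case: (lift_edge_uniq treeS mono xy xy' erefl fyy) => //; rewrite eq_sym.
by apply/subsetP=> _ /imsetP[y yP ->]; move: yP; rewrite !inE => /andP[/hom-> ->].
Qed.

Lemma fibre_low_order (S T : finType) (eS : rel S) (eT : rel T) (f : S -> T) x y :
  is_tree eS -> monotone eS eT f -> x != y -> f x = f y -> vorder eT (f x) <= 3 ->
  exists z, f z = f x /\ vorder eS z <= 2.
Proof.
move=> treeS mono nxy fxy ordT.
have syme : symmetric (fibre_rel eS f) by apply: fibre_rel_sym; case: treeS => [[]].
have brd := fibre_rel_bridged (f := f) (tree_bridged treeS).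
have fib u v := @connect_fibre _ _ eS f u v.
have [l1 [nl1 xl1 o1]] := leaf_neq syme brd nxy (monotone_fibre mono fxy).
have l1x : connect (fibre_rel eS f) l1 x by rewrite (sym_connect_sym syme).
(* Rooting the fibre at [l1] gives a leaf different from [l1]. *)
have [l2 [nl2 xl2 o2]] := leaf_neq syme brd nl1 l1x.
have [low1|high1] := leqP (vorder eS l1) 2; first by exists l1; rewrite (fib _ _ xl1).
have fl2 : f l2 = f x by rewrite (fib _ _ xl2) (fib _ _ xl1).
have fl1 := fib _ _ xl1.
have [low2|high2] := leqP (vorder eS l2) 2; first by exists l2.
have [c1 s1] := exits_image l1 treeS mono.
have [c2 s2] := exits_image l2 treeS mono.
(* Order at least 3, with at most one edge inside the fibre, leaves two exits at each leaf. Their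
   images are four distinct neighbours of [f x], one more than allowed. *)
have e1 : 2 <= #|exits eS f l1|.
  by rewrite -(leq_add2l 1) (leq_trans high1) // (vorder_exits eS f) leq_add2r.
have e2 : 2 <= #|exits eS f l2|.
  by rewrite -(leq_add2l 1) (leq_trans high2) // (vorder_exits eS f) leq_add2r.
have dis : [disjoint f @: exits eS f l1 & f @: exits eS f l2].
  apply/pred0P=> b /=; apply/negP=> /andP[/imsetP[y1 y1P ->] /imsetP[y2 y2P fyy]].
  move: y1P y2P; rewrite !inE => /andP[e11 n1] /andP[e22 n2].
  have [] := lift_edge_uniq treeS mono e11 e22 _ fyy; rewrite ?fl1 ?fl2 //.
    by rewrite -fl1 eq_sym.
  by move=> D; rewrite D eqxx in nl2.
have : #|f @: exits eS f l1 :|: f @: exits eS f l2| <= 3.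
  apply: leq_trans ordT; apply: subset_leq_card.
  by rewrite fl1 fl2 in s1 s2; rewrite subUset s1 s2.
rewrite cardsU disjoint_setI0 // cards0 subn0 c1 c2 leqNgt.
by rewrite (leq_trans _ (leq_add e1 e2)).
Qed.

(** Provides a place to attach a leaf. In a one-point fibre all edges are exits and inject into
    those at [a]; a larger fibre falls under [fibre_low_order]. *)
Lemma fibre_leaf_site (S T : finType) (eS : rel S) (eT : rel T) (f : S -> T) (a : T) :
  is_tree eS -> monotone eS eT f -> vorder eT a <= 2 ->
  exists z, f z = a /\ vorder eS z <= 2.
Proof.
move=> treeS mono ordT; have [[_ surj _] _] := mono; have [x Dx] := surj a; subst a.
have [/existsP[y /andP[nxy /eqP fxy]]|] := boolP [exists y, (x != y) && (f x == f y)].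
  by apply: fibre_low_order mono nxy fxy _ => //; apply: leq_trans ordT _.
rewrite negb_exists => /forallP single; exists x; split=> //.
have [c s] := exits_image x treeS mono.
rewrite (vorder_exits eS f) -c addnC -[2]addn0 leq_add //.
  exact: leq_trans (subset_leq_card s) ordT.
rewrite leqn0 cards_eq0; apply/eqP/setP=> y; rewrite !inE /fibre_rel.
by have := single y; rewrite eq_sym negb_and negbK => /orP[->|/negPf->]; rewrite ?andbF.
Qed.

(** * Subdividing an edge or attaching a leaf *)

Lemma leq_card_inj (S T : finType) (h : S -> T) (A : {set S}) (B : {set T}) :
  {in A &, injective h} -> {in A, forall x, h x \in B} -> #|A| <= #|B|.
Proof.
move=> injh subh; rewrite -(card_in_imset injh); apply: subset_leq_card.
by apply/subsetP=> _ /imsetP[x Ax ->]; apply: subh.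
Qed.

(* For [u != v] this subdivides the edge [uv] by the new vertex [None]; for
   [u = v] it attaches [None] as a leaf at [u]. *)
Definition subdivide (T : finType) (e : rel T) (u v : T) : rel (option T) :=
  fun x y =>
    match x, y with
    | Some z, Some w => (z == w) || del_edge e u v z w
    | Some z, None | None, Some z => (z == u) || (z == v)
    | None, None => true
    end.

Lemma del_edge_swap (T : finType) (e : rel T) x y :
  del_edge e x y =2 del_edge e y x.
Proof. by move=> z w; rewrite /del_edge orbC. Qed.

Lemma del_edgeE (T : finType) (e : rel T) u v z w :
  e z w -> ~~ del_edge e u v z w -> (z = u /\ w = v) \/ (z = v /\ w = u).
Proof.
rewrite /del_edge => -> /=; rewrite negbK !xpair_eqE.
by case/orP=> /andP[/eqP-> /eqP->]; [left | right].
Qed.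

Lemma subdivide_graph (T : finType) (e : rel T) u v :
  is_graph e -> is_graph (subdivide e u v).
Proof.
case=> refle syme; split=> [[z|]|[z|] [w|]] //=; rewrite ?eqxx //.
by rewrite eq_sym (del_edge_sym _ _ syme).
Qed.

Lemma subdivide_monotone (T : finType) (e : rel T) u v :
  is_graph e -> e u v -> monotone (subdivide e u v) e (odflt u).
Proof.
case=> refle syme euv; apply: monotoneI; first split.
- move=> [z|] [w|] //=; first by case/predU1P=> [->|/andP[]].
    by case/orP=> /eqP-> //; rewrite syme.
  by case/orP=> /eqP->.
- by move=> z; exists (Some z).
- move=> z w ezw; have [del|/(del_edgeE ezw)[[-> ->]|[-> ->]]] := boolP (del_edge e u v z w).
  + by exists (Some z), (Some w); rewrite /= del orbT.
  + by exists None, (Some v); rewrite /= eqxx orbT.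
  + by exists (Some v), None; rewrite /= eqxx orbT.
by move=> [z|] [w|] //= Dz; rewrite ?Dz //; apply: connect1; rewrite /fibre_rel /= ?Dz !eqxx.
Qed.

(** Sending [None] to a suitable endpoint turns a walk around an edge of the subdivision into a walk
    around an edge of [e]. *)
Lemma subdivide_tree (T : finType) (e : rel T) u v :
  is_tree e -> e u v -> is_tree (subdivide e u v).
Proof.
move=> treeT euv; have [[refle syme] _] := treeT; have brd := tree_bridged treeT.
have graphD := subdivide_graph u v (conj refle syme); have [reflD symD] := graphD.
have connSS z w : connect (subdivide e u v) (Some z) (Some w).
  apply: (connect_hom _ (tree_connect z w treeT)) => {}z {}w ezw.
  have [del|/(del_edgeE ezw) Dzw] := boolP (del_edge e u v z w).
    by apply: connect1; rewrite /= del orbT.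
  by apply: connect_trans (@connect1 _ _ _ None _) (connect1 _);
    case: Dzw => -[Dz Dw]; rewrite ?Dz ?Dw /= eqxx ?orbT.
have connNS z : connect (subdivide e u v) None (Some z).
  by apply: connect_trans (connect1 _) (connSS u z); rewrite /= eqxx.
apply: bridged_tree => // [[z|] [w|]|] //.
  by rewrite (sym_connect_sym symD).
have brdN z w : (u = z /\ v = w) \/ (u = w /\ v = z) ->
    ~~ connect (del_edge (subdivide e u v) None (Some z)) None (Some z).
  move=> Duv; have ewz : e w z by case: Duv => [[<- <-]|[<- <-]]; rewrite // syme.
  have edgeN t : subdivide e u v None (Some t) -> t != z -> t = w.
    by move=> /= /orP[]/eqP->; case: Duv => -[Du Dv]; rewrite ?Du ?Dv ?eqxx.
  (* Here [u = v], and the deleted edge was the only one joining [None] to another vertex. *)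
  have [Dw | nwz] := eqVneq w z.
    apply/negP=> conn; suff: Some z \in pred1 None by [].
    apply: (connect_closed _ conn); rewrite ?inE // => x [t|]; rewrite !inE // => /eqP-> /andP[].
    move/edgeN; have [->|_ /(_ isT)->] := eqVneq t z; first by rewrite eqxx.
    by rewrite Dw eqxx.
  (* Once its edge to [z] is deleted, [None] is adjacent only to [w], so it can be collapsed onto
     [w]. *)
  apply: contra (brd _ _ nwz ewz); apply: (@connect_hom _ _ _ _ (odflt w)).
  have N1 t : del_edge (subdivide e u v) None (Some z) None (Some t) -> t = w.
    case/andP=> /edgeN; have [->|_ /(_ isT)->] := eqVneq t z; by rewrite ?eqxx.
  case=> [t|] [t'|] //; last by move/N1->.
    case/andP=> /predU1P[->|del _] //=; apply: connect1; move: del.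
    by case: Duv => [[-> ->]|[-> ->]]; rewrite ?[del_edge e z w _ _]del_edge_swap.
  by rewrite (del_edge_sym _ _ symD) => /N1->.
have {}brdN z : subdivide e u v None (Some z) ->
    ~~ connect (del_edge (subdivide e u v) None (Some z)) None (Some z).
  by case/orP=> /eqP->; [apply: (brdN _ v) | apply: (brdN _ u)]; [left | right].
move=> [z|] [w|] //= nzw; last exact: brdN.
  have {}nzw : z != w by apply: contra nzw => /eqP->.
  rewrite (negPf nzw) => /andP[ezw nd].
  (* The edge [zw] is not [uv], so [uv] survives its deletion and a passage through [None] can be
     replaced by [uv]. *)
  have deluv : del_edge e z w u v.
    by move: nd; rewrite /del_edge euv !xpair_eqE /= ![_ == u]eq_sym ![_ == v]eq_sym [(v == z) && _]andbC.
  have delvu : del_edge e z w v u by rewrite (del_edge_sym _ _ syme).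
  apply: contra (brd _ _ nzw ezw); apply: (@connect_hom _ _ _ _ (odflt u)).
  case=> [t|] [t'|] //=; rewrite {1}/del_edge /=.
  - case/andP=> /predU1P[->|/andP[ett _]] // ndt; apply: connect1.
    by rewrite /del_edge ett.
  - by case/andP=> /orP[]/eqP-> _ //; apply: connect1.
  - by case/andP=> /orP[]/eqP-> _ //; apply: connect1.
move/brdN; rewrite (sym_connect_sym (del_edge_sym _ _ symD)).
by rewrite (eq_connect (del_edge_swap _ _ _)).
Qed.

Lemma subdivide_order (T : finType) (e : rel T) u v :
  is_graph e -> e u v -> (forall x, vorder e x <= 3) -> (u = v -> vorder e u <= 2) ->
  forall x, vorder (subdivide e u v) x <= 3.
Proof.
move=> [refle syme] euv ord3 ord2 [x|]; last first.
  apply: leq_trans (_ : #|[set Some u; Some v]| <= _); last by rewrite cards2; case: (_ != _).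
  by apply/subset_leq_card/subsetP=> -[z|]; rewrite !inE => /andP[].
(* Only the vertex receiving a leaf gains a neighbour; this is where the bound 2 is used. *)
have [/andP[/eqP Duv /eqP Dx]|] := boolP ((u == v) && (x == u)).
  apply: leq_trans (_ : #|None |: Some @: [set y | e x y & y != x]| <= _).
    apply/subset_leq_card/subsetP=> -[z|]; rewrite !inE //= => /andP[/predU1P[->|]].
      by rewrite eqxx.
    by case/andP=> exz _ nzx; apply: imset_f; rewrite inE exz nzx.
  rewrite cardsU1 (leq_trans (leq_add (leq_b1 _) (leq_imset_card _ _))) //.
  by rewrite add1n ltnS Dx; apply: ord2.
move=> nux; apply: leq_trans (ord3 x).
(* At an endpoint of the subdivided edge, [None] takes the place of the other endpoint. *)
apply: (@leq_card_inj _ _ (odflt (if x == u then v else u))).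
  have key z : subdivide e u v (Some x) (Some z) -> Some z != Some x ->
      (x == u) || (x == v) -> z <> (if x == u then v else u).
    move=> /= exz nzx Dx Dz; move: exz; rewrite eq_sym.
    have /negPf-> /= : z != x by apply: contra nzx => /eqP->.
    rewrite /del_edge Dz !xpair_eqE; case: eqP Dx => [->|_] /=; first by rewrite !eqxx andbF.
    by move->; rewrite eqxx andbF.
  move=> [z|] [w|] //; rewrite !inE => /andP[ez nz] /andP[ew nw] //=.
  - by move->.
  - by move/(key _ ez nz ew).
  - by move/esym/(key _ ew nw ez).
move=> [z|]; rewrite !inE /= => /andP[].
  case/predU1P=> [->|/andP[-> _]]; first by rewrite eqxx.
  by move=> nzx; apply: contra nzx => /eqP->.
move=> Dx _; move: nux Dx; have [->|nxu] := eqVneq x u.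
  by rewrite andbT euv eq_sym => ->.
by move=> _ /= /eqP Dx; rewrite [u == x]eq_sym nxu Dx syme euv.
Qed.

(** * Contracting a vertex with at most two neighbours *)

(* The quotient collapsing [b] into [b'], for [b] with neighbours [b'] and [c']
   only ([c' = b'] if [b] is a leaf), realised on the complement of [b]. *)
Definition contract (T : finType) (e : rel T) (b b' c' : T) : rel {x | x != b} :=
  fun x y => [|| e (val x) (val y), (val x, val y) == (b', c') | (val x, val y) == (c', b')].

Lemma contract_graph (T : finType) (e : rel T) (b b' c' : T) :
  is_graph e -> is_graph (@contract T e b b' c').
Proof.
case=> refle syme; split=> [x|x y]; first by rewrite /contract refle.
rewrite /contract syme !xpair_eqE; congr (_ || _).
by rewrite orbC andbC [X in _ || X]andbC.
Qed.

Lemma contract_monotone (T : finType) (e : rel T) (b b' c' : T) (nb : b' != b) :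
  is_graph e -> e b b' -> e b c' -> c' != b ->
  (forall y, e b y -> [|| y == b, y == b' | y == c']) ->
  monotone e (@contract T e b b' c') (insubd (exist _ b' nb)).
Proof.
move=> [refle syme] ebb' ebc' nc nbhd.
set p := insubd _; have valp x : val (p x) = if x == b then b' else x.
  by rewrite val_insubd /=; case: eqP.
have pval x : p (val x) = x by apply: val_inj; rewrite valp (negPf (valP x)).
have pS x (nx : x != b) : p x = exist _ x nx by apply: val_inj; rewrite valp (negPf nx).
have pb : p b = exist _ b' nb by apply: val_inj; rewrite valp eqxx.
apply: monotoneI; first split.
- have cb y : e b y -> contract e b' c' (p b) (p y).
    move=> eby; have [->|ny] := eqVneq y b; first by rewrite /contract refle.
    rewrite /contract !valp eqxx (negPf ny); move: (nbhd _ eby); rewrite (negPf ny) /=.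
    by case/orP=> /eqP->; rewrite ?refle ?eqxx ?orbT.
  move=> x y exy; have [Dx|nx] := eqVneq x b; first by rewrite Dx cb // -Dx.
  have [Dy|ny] := eqVneq y b.
    by have [_ ->] := @contract_graph _ e b b' c' (conj refle syme); rewrite Dy cb // syme -Dy.
  by rewrite /contract !valp (negPf nx) (negPf ny) exy.
- by move=> x; exists (val x); rewrite pval.
- move=> x y /or3P[exy|/eqP[Dx Dy]|/eqP[Dx Dy]].
  + by exists (val x), (val y); rewrite !pval.
  + by exists b, c'; split=> //; apply: val_inj; rewrite valp ?eqxx ?(negPf nc).
  + by exists c', b; rewrite syme; split=> //; apply: val_inj; rewrite valp ?eqxx ?(negPf nc).
move=> x y pxy; have := congr1 val pxy; rewrite !valp.
have [->|nx] := eqVneq x b; have [->|ny] := eqVneq y b => // Dxy.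
- by apply: connect1; rewrite /fibre_rel -Dxy ebb' pb pS /=.
- by apply: connect1; rewrite /fibre_rel Dxy syme ebb' pb pS /=.
by rewrite Dxy.
Qed.

(** The edge added between [b'] and [c'] replaces, at either end, the lost edge to [b]; so [h]
    counts the new neighbour as [b]. *)
Lemma contract_order (T : finType) (e : rel T) (b b' c' : T) x :
  symmetric e -> e b b' -> e b c' -> vorder (@contract T e b b' c') x <= vorder e (val x).
Proof.
move=> syme ebb' ebc'; pose h (y : {y | y != b}) := if e (val x) (val y) then val y else b.
apply: (@leq_card_inj _ _ h) => [y z|y]; rewrite !inE /h /contract.
  case/andP=> ey ny /andP[ez nz]; move: ey ez.
  case: ifP => ey; case: ifP => ez /=.
  - by move=> _ _ /val_inj.
  - by move=> _ _ Dy; case/eqP: (valP y).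
  - by move=> _ _ Dz; case/eqP: (valP z).
  move=> + + _; case/orP=> /eqP[Dx Dy] /orP[]/eqP[Dx' Dz]; apply: val_inj => //=;
    by rewrite Dy Dz // -Dx -Dx'.
case/andP=> ey ny; move: ey; case: ifP => [-> _|_ /=].
  by apply: contra ny => /eqP/val_inj->.
rewrite [b == _]eq_sym (valP x) andbT syme.
by case/orP=> /eqP[-> _].
Qed.

(** Removing a leaf frees one place at its neighbour, which is what lets a leaf be attached
    upstairs. *)
Lemma contract_leaf_order (T : finType) (e : rel T) (b b' : T) x :
  e b' b -> e b' b' -> val x = b' -> vorder (@contract T e b b' b') x < vorder e b'.
Proof.
move=> eb'b eb'b' Dx; have nb : b != b' by rewrite -Dx eq_sym (valP x).
rewrite /vorder (cardsD1 b [set _ | _]) inE eb'b nb ltnS.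
apply: (@leq_card_inj _ _ val) => [y z _ _ /val_inj //|y].
rewrite !inE /contract -Dx (valP y) /= => /andP[ey nyx].
rewrite (contra _ nyx) => [|/eqP/val_inj-> //]; rewrite andbT.
by move: ey; rewrite Dx orbb; case/orP=> // /eqP[->].
Qed.

(** * Undoing the contraction above *)

(** The new vertex [None] is placed over the restored vertex [b]. The edge [uv] being the only one
    above a non-degenerate [b'c'], subdividing it removes exactly what the quotient had added. *)
Lemma monotone_extend (T D : finType) (e : rel T) (eD : rel D) (b b' c' : T)
    (f : D -> {x | x != b}) (u v : D) :
  is_tree e -> is_tree eD -> e b b' -> e b c' ->
  (forall y, e b y -> [|| y == b, y == b' | y == c']) ->
  monotone eD (@contract T e b b' c') f ->
  val (f u) = b' -> val (f v) = c' -> eD u v -> (b' = c' -> u = v) ->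
  monotone (subdivide eD u v) e (oapp (val \o f) b).
Proof.
move=> treeT treeD ebb' ebc' nbhd mono Du Dv euv uvE.
have [[refle syme] _] := treeT; have [[reflD symD] _] := treeD.
have [[hom surj lift] _] := mono.
have nbv x : (val (f x) == b) = false by exact: negbTE (valP (f x)).
(* An edge [b'c'] would close a triangle with [b]. *)
have notri : b' != c' -> ~~ e b' c'.
  move=> nbc; apply/negP=> ebc; case/negP: (tree_bridged treeT nbc ebc).
  have [nbb' nbc'] : b != b' /\ b != c' by rewrite -Du -Dv !(eq_sym b) !nbv.
  apply: connect_trans (@connect1 _ _ _ b _) (connect1 _); rewrite /del_edge.
    by rewrite syme ebb' !xpair_eqE (negPf nbb') (negPf nbc') !andbF.
  by rewrite ebc' !xpair_eqE (negPf nbb') (negPf nbc').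
have homN z : (z == u) || (z == v) -> e b (val (f z)).
  by case/orP=> /eqP->; rewrite ?Du ?Dv.
apply: monotoneI; first split.
- move=> [z|] [w|] //=; [|by rewrite syme; apply: homN|exact: homN].
  case/predU1P=> [->//|/andP[ezw nd]].
  (* For [b' = c'] this is reflexivity; otherwise unique lifting forces the edge to be [uv], which
     was removed. *)
  have keep z' w' : eD z' w' -> val (f z') = b' -> val (f w') = c' ->
      (z', w') != (u, v) -> e b' c'.
    move=> ezw' Dz Dw; have [<- //|nbc] := eqVneq b' c'.
    have [|||-> -> /eqP//] := lift_edge_uniq treeD mono ezw' euv.
    - by apply: val_inj; rewrite Dz Du.
    - by apply: val_inj; rewrite Dw Dv.
    - by apply: contra nbc => /eqP Dzw; rewrite -Dz -Dw Dzw.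
  move: nd; rewrite negb_or => /andP[nd nd'].
  case/or3P: (hom _ _ ezw) => // /eqP[Dz Dw]; rewrite Dz Dw; first exact: keep ezw Dz Dw nd.
  rewrite syme; apply: keep (Dw) (Dz) _; first by rewrite symD.
  by rewrite !xpair_eqE andbC in nd' *.
- move=> x; have [->|nx] := eqVneq x b; first by exists None.
  by have [z Dz] := surj (exist _ x nx); exists (Some z); rewrite /= Dz.
- have liftN y : e b y -> exists a, [/\ subdivide eD u v None a & oapp (val \o f) b a = y].
    case/nbhd/or3P=> /eqP->; first by exists None.
      by exists (Some u); rewrite /= eqxx.
    by exists (Some v); rewrite /= eqxx orbT.
  move=> x y; have [->|nx] := eqVneq x b.
    by case/liftN=> a [ea <-]; exists None, a.
  have [->|ny] := eqVneq y b.
    by rewrite syme => /liftN[a [ea <-]]; exists a, None.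
  move=> exy; have exy' : contract e b' c' (exist _ x nx) (exist _ y ny) by rewrite /contract exy.
  have [z [w [ezw Dz Dw]]] := lift _ _ exy'.
  exists (Some z), (Some w); rewrite /= Dz Dw; split=> //.
  have [del|/(del_edgeE ezw) Dzw] := boolP (del_edge eD u v z w); first by rewrite orbT.
  have [/uvE Duv|/notri/negP[]] := altP (b' =P c').
    by case: Dzw => [[-> ->]|[-> ->]]; rewrite Duv eqxx.
  by case: Dzw exy => [[zE wE]|[zE wE]]; move: Dz Dw; rewrite zE wE => Dz Dw;
    rewrite -Du -Dv Dz Dw //= syme.
move=> [z|] [w|] //= Dzw; last first.
- by case/eqP: (valP (f w)).
- by case/eqP: (valP (f z)).
move/val_inj: Dzw => /(monotone_fibre mono); apply: connect_hom => t t' /andP[ett /eqP ft].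
apply: connect1; rewrite /fibre_rel /= ft eqxx andbT.
have [del|/(del_edgeE ett) Dt] := boolP (del_edge eD u v t t'); first by rewrite orbT.
have Duv : u = v by apply: uvE; rewrite -Du -Dv; case: Dt ft => [[-> ->]|[-> ->]] ->.
by case: Dt => [[-> ->]|[-> ->]]; rewrite Duv eqxx.
Qed.

(** * Induction on the size of [B], and the two properties *)

Lemma eq_monotone (S T : finType) (eS : rel S) (eT : rel T) (f g : S -> T) :
  f =1 g -> monotone eS eT f -> monotone eS eT g.
Proof.
move=> fg [[hom surj lift] mono]; split=> [|U /mono]; last first.
  by congr (connected _ _); apply/setP=> x; rewrite !inE fg.
split=> [x y /hom|y|y y' /lift[x [x' [exx <- <-]]]]; first by rewrite !fg.
  by have [x <-] := surj y; exists x.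
by exists x, x'; rewrite !fg.
Qed.

Lemma connect_neighbour (T : finType) (e : rel T) x y :
  connect e x y -> x != y -> exists2 z, e x z & z != x.
Proof.
move/connectP=> [p0 /shortenP[[|z p] /= pth up _] ->]; first by rewrite eqxx.
case/andP: pth => xz _ _; exists z => //.
by case/andP: up; rewrite inE negb_or eq_sym => /andP[].
Qed.

(** Stated for trees of any size, since repeated contraction over a one-vertex [A] ends in a single
    vertex. *)
Lemma amalgamation (A B C : finType) (eA : rel A) (eB : rel B) (eC : rel C)
    (f : B -> A) (g : C -> A) :
  (forall a, vorder eA a <= 3) ->
  is_tree eB -> (forall b, vorder eB b <= 3) ->
  is_tree eC -> (forall c, vorder eC c <= 3) ->
  monotone eB eA f -> monotone eC eA g ->
  exists (D : finType) (eD : rel D) (f0 : D -> B) (g0 : D -> C),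
    [/\ is_tree eD /\ (forall d, vorder eD d <= 3), monotone eD eB f0,
        monotone eD eC g0 & forall d, f (f0 d) = g (g0 d)].
Proof.
move=> ordA; have [n] := ubnP #|B|; elim: n => // n IHn in B eB f *.
rewrite ltnS => leBn treeB ordB treeC ordC monof monog.
have [[reflB symB] _] := treeB.
have [/injectiveP injf|/injectivePn[x [y nxy fxy]]] := boolP (injectiveb f).
  have [[homf surjf liftf] _] := monof; have [[homg surjg liftg] _] := monog.
  have invf a : {b | f b = a}.
    have : exists b, f b == a by have [b <-] := surjf a; exists b.
    by move/sigW => [b /eqP]; exists b.
  (* An injective epimorphism is an isomorphism, so [f0] is [g] followed by the inverse of [f]. *)
  pose f0 c := sval (invf (g c)); have f0P c : f (f0 c) = g c by rewrite /f0; case: (invf _).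
  exists C, eC, f0, id; split=> //; last first.
    apply: monotoneI; first by split=> [|c|c c']; [|exists c|exists c, c'].
    by move=> c c' ->.
  apply: monotoneI; first split.
  - move=> c c' /homg/liftf[b [b' [ebb]]].
    by rewrite -!f0P => /injf <- /injf <-.
  - by move=> b; have [c Dc] := surjg (f b); exists c; apply: injf; rewrite f0P.
  - move=> b b' /homf/liftg[c [c' [ecc Dc Dc']]]; exists c, c'.
    by split=> //; apply: injf; rewrite f0P.
  move=> c c' fcc; have gcc : g c = g c' by rewrite -!f0P fcc.
  apply: connect_sub (monotone_fibre monog gcc) => z w /andP[ezw /eqP gzw].
  by apply: connect1; rewrite /fibre_rel ezw /f0 gzw /=.
have [b [fb ordb]] := fibre_low_order treeB monof nxy fxy (ordA _).
have [z nbz fz] : exists2 z, b != z & f b = f z.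
  by have [Db|nbx] := eqVneq b x; [exists y; rewrite Db | exists x].
have [b' /andP[ebb' /eqP fbb'] nb'] := connect_neighbour (monotone_fibre monof fz) nbz.
(* The second neighbour of [b], or [b'] again when [b] is a leaf. *)
have [c' [ebc' nc' nbhd]] : exists c', [/\ eB b c', c' != b &
    forall y, eB b y -> [|| y == b, y == b' | y == c']].
  move: ordb; rewrite /vorder; set N := [set _ | _]; rewrite (cardsD1 b' N).
  rewrite [b' \in N]inE ebb' nb' ltnS => /card_le1_eqP N1.
  have [N0|[c']] := set_0Vmem (N :\ b').
    exists b'; split=> // w ebw; move/setP/(_ w): N0; rewrite !inE ebw.
    by case: eqP; case: eqP.
  move=> Nc'; exists c'; have := Nc'; rewrite !inE => /and3P[_ -> ->]; split=> // w ebw.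
  have [//|nwb] := eqVneq w b; have [//|nwb'] := eqVneq w b'.
  by apply/eqP/N1; rewrite // !inE nwb' ebw.
set e' := @contract B eB b b' c'.
have graph' : is_graph e' by apply: contract_graph; case: treeB.
have monop : monotone eB e' (insubd (exist _ b' nb')).
  by apply: contract_monotone => //; case: treeB.
have tree' : is_tree e' by apply: monotone_tree monop.
have ord' w : vorder e' w <= 3 by apply: leq_trans (contract_order _ _ _ _) (ordB _).
(* Since [f b = f b'], the map [f] factors through the contraction. *)
have monof' : monotone e' eA (f \o val).
  have [epip _] := monop; apply: monotone_factor epip _; apply: eq_monotone monof => w /=.
  by rewrite val_insubd /=; case: eqP => // ->.
have lt' : #|{: {w | w != b}}| < n.
  apply: leq_trans leBn; rewrite card_sig (eq_card (B := predC1 b)) // cardC1 ltn_predL.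
  by apply/card_gt0P; exists b.
have [D [eD [f0 [g0 [[treeD ordD] monof0 monog0 fg]]]]] := IHn _ _ _ lt' tree' ord' treeC ordC monof' monog.
have [graphD _] := treeD.
(* For a leaf, [u = v] is a vertex of order at most 2 above [b']; otherwise [uv] lifts the edge
   [b'c'] of the quotient. *)
have [u [v [Du Dv euv uvE ordu]]] : exists u v, [/\ val (f0 u) = b', val (f0 v) = c',
    eD u v, b' = c' -> u = v & u = v -> vorder eD u <= 2].
  have [Dc|nbc] := eqVneq b' c'.
    have low : vorder e' (exist _ b' nb') <= 2.
      rewrite -ltnS (leq_trans _ (ordB b')) // /e' -Dc.
      by apply: contract_leaf_order; rewrite // symB.
    have [u [Du ordu]] := fibre_leaf_site treeD monof0 low.
    by exists u, u; rewrite Du -Dc; split=> //; case: graphD.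
  have [[_ _ lift] _] := monof0.
  have [|u [v [euv Du Dv]]] := lift (exist _ b' nb') (exist _ c' nc').
    by rewrite /e' /contract /= eqxx orbT.
  exists u, v; rewrite Du Dv; split=> //= [Dbc|Duv]; first by rewrite Dbc eqxx in nbc.
  by case/eqP: nbc; move: Dv; rewrite -Duv Du => /(congr1 val).
(* The new vertex goes to [b] in [B] and to [g0 u] in [C]; the square commutes there because
   [f b = f b']. *)
exists (option D), (subdivide eD u v), (oapp (val \o f0) b), (g0 \o odflt u); split.
- by split; [apply: subdivide_tree | apply: subdivide_order].
- exact: monotone_extend monof0 Du Dv euv uvE.
- by apply: monotone_comp monog0; apply: subdivide_monotone.
- by move=> [d|] /=; rewrite -fg //= Du.
Qed.

(** [D] maps onto [B], so it has at least two vertices. Only orders in [A] are bounded, which admits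
    the one-vertex graph for joint projection. *)
Lemma TM3_amalgamation (A B C : finType) (eA : rel A) (eB : rel B) (eC : rel C)
    (f : B -> A) (g : C -> A) :
  (forall a, vorder eA a <= 3) -> TM3 eB -> TM3 eC ->
  monotone eB eA f -> monotone eC eA g ->
  exists (D : finType) (eD : rel D) (f0 : D -> B) (g0 : D -> C),
    [/\ TM3 eD, monotone eD eB f0, monotone eD eC g0 & forall d, f (f0 d) = g (g0 d)].
Proof.
move=> ordA [treeB cardB ordB] [treeC _ ordC] monof monog.
have [D [eD [f0 [g0 [[treeD ordD] monof0 monog0 fg]]]]] :=
  amalgamation ordA treeB ordB treeC ordC monof monog.
exists D, eD, f0, g0; split=> //; split=> //; apply: leq_trans cardB _.
have [[_ surj _] _] := monof0.
rewrite -!cardsT; apply: leq_trans (leq_imset_card f0 _); apply: subset_leq_card.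
by apply/subsetP=> b _; have [d <-] := surj b; apply: imset_f.
Qed.

Lemma monotone_unit (T : finType) (e : rel T) :
  TM3 e -> monotone e (fun _ _ : unit => true) (fun=> tt).
Proof.
case=> treeT card2 _; have [x _] : exists x, x \in T by apply/card_gt0P/ltnW.
have [[refle _] _] := treeT; apply: monotoneI.
  by split=> // [[]|[] []]; [exists x | exists x, x].
move=> y z _; apply: connect_sub (tree_connect y z treeT) => u v euv.
by apply: connect1; rewrite /fibre_rel euv eqxx.
Qed.

Theorem theorem3p13 :
  (* joint projection property *)
  (forall (B C : finType) (eB : rel B) (eC : rel C),
      TM3 eB -> TM3 eC ->
      exists (D : finType) (eD : rel D) (f : D -> B) (g : D -> C),
        [/\ TM3 eD, monotone eD eB f & monotone eD eC g]) /\
  (* projective amalgamation property *)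
  (forall (A B C : finType) (eA : rel A) (eB : rel B) (eC : rel C)
          (f : B -> A) (g : C -> A),
      TM3 eA -> TM3 eB -> TM3 eC ->
      monotone eB eA f -> monotone eC eA g ->
      exists (D : finType) (eD : rel D) (f0 : D -> B) (g0 : D -> C),
        [/\ TM3 eD, monotone eD eB f0, monotone eD eC g0 &
            forall d, f (f0 d) = g (g0 d)]).
Proof.
split=> [B C eB eC TB TC|A B C eA eB eC f g [_ _ ordA]]; last exact: TM3_amalgamation.
have ord1 (a : unit) : vorder (fun _ _ => true) a <= 3.
  by rewrite (leq_trans (max_card _)) // card_unit.
have [D [eD [f [g [TD monof monog _]]]]] :=
  TM3_amalgamation ord1 TB TC (monotone_unit TB) (monotone_unit TC).
by exists D, eD, f, g.
Qed.
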